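(* Let $Q$ be a nondegenerate symmetric bilinear form on a vector space $V$ of dimension $n$ over a field $F$ of characteristic $\neq 2$. Let $C\ell(V,Q)$ denote the corresponding Clifford algebra, and let $\mathfrak{Z}(V,Q)$ denote the center of $C\ell(V,Q)$. Let $\{e_1,\dots,e_n\}$ be a $Q$-orthogonal basis of $V$ and let $\omega = e_1\cdots e_n$. Then: 1) If $n$ is even, then (a) $\varphi\,\omega = \omega\,\alpha(\varphi)$ for all $\varphi \in C\ell(V,Q)$, and (b) $\mathfrak{Z}(V,Q) = F$. 2) If $n$ is odd, then $\mathfrak{Z}(V,Q) = F\text{-span}\{1,\omega\}$. 3) $\omega^2 = (-1)^{\frac{n(n-1)}{2}}\, e_1^2\cdots e_n^2$.
   Context: $C\ell(V,Q)$ is the universal associative unital $F$-algebra containing $V$ in which $v\cdot v = -Q(v,v)1$ for all $v\in V$; $F$ is identified with $F\cdot 1$. $\alpha$ is the unique algebra automorphism of $C\ell(V,Q)$ with $\alpha(v)=-v$ for all $v\in V$. A basis is $Q$-orthogonal if $Q(e_i,e_j)=0$ for $i\ne j$. *)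

(* Defs.v *)
From mathcomp Require Import all_boot all_order all_algebra.

Set Implicit Arguments.
Unset Strict Implicit.
Unset Printing Implicit Defensive.

Import GRing.Theory.
Local Open Scope ring_scope.

(* [iota : V -> C] exhibits [C] as the Clifford algebra of [(V, Q)], with the
   sign convention [v * v = - Q(v, v)].  This determines [(C, iota)] up to a
   unique isomorphism.  Uniqueness of [g] is stated pointwise, since
   [{lrmorphism C -> B}] bundles the function with proofs. *)
Record is_clifford_algebra (F : fieldType) (V : vectType F)
    (Q : {symmetric V}) (C : algType F) (iota : {linear V -> C}) : Prop :=
  IsCliffordAlgebra {
    clifford_inj : injective iota;
    clifford_sqr : forall v : V, iota v * iota v = - (Q v v)%:A;
    clifford_ex : forall (B : algType F) (f : {linear V -> B}),
      (forall v : V, f v * f v = - (Q v v)%:A) ->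
      exists g : {lrmorphism C -> B}, forall v : V, g (iota v) = f v;
    clifford_uniq : forall (B : algType F) (f : {linear V -> B}),
      (forall v : V, f v * f v = - (Q v v)%:A) ->
      forall g g' : {lrmorphism C -> B},
        (forall v : V, g (iota v) = f v) ->
        (forall v : V, g' (iota v) = f v) -> g =1 g'
  }.

Definition is_main_automorphism (F : fieldType) (V : vectType F)
    (C : algType F) (iota : {linear V -> C})
    (alpha : {lrmorphism C -> C}) : Prop :=
  bijective alpha /\ forall v : V, alpha (iota v) = - iota v.

Lemma main_automorphism_ex (F : fieldType) (V : vectType F)
    (Q : {symmetric V}) (C : algType F) (iota : {linear V -> C}) :
  is_clifford_algebra Q iota ->
  exists alpha : {lrmorphism C -> C}, is_main_automorphism iota alpha.
Proof.
move=> cl.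
have sqN (v : V) : (\- iota) v * (\- iota) v = - (Q v v)%:A.
  by rewrite /= mulrNN (clifford_sqr cl).
have [alpha alphaE] := clifford_ex cl sqN.
have alphaK : alpha \o alpha =1 idfun.
  apply: (@clifford_uniq _ _ _ _ _ cl C iota (clifford_sqr cl)
    (alpha \o alpha) idfun) => v //=.
  by rewrite alphaE /= raddfN /= alphaE /= opprK.
by exists alpha; split=> //; exists alpha => x; exact: alphaK.
Qed.

Lemma main_automorphism_uniq (F : fieldType) (V : vectType F)
    (Q : {symmetric V}) (C : algType F) (iota : {linear V -> C})
    (alpha beta : {lrmorphism C -> C}) :
  is_clifford_algebra Q iota ->
  is_main_automorphism iota alpha -> is_main_automorphism iota beta ->
  alpha =1 beta.
Proof.
move=> cl [_ alphaE] [_ betaE].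
apply: (@clifford_uniq _ _ _ _ _ cl C (\- iota)) => v //=.
by rewrite mulrNN (clifford_sqr cl).
Qed.

Definition in_center (F : fieldType) (C : algType F) (z : C) : Prop :=
  forall x : C, z * x = x * z.

Definition orthogonal_family (F : fieldType) (V : vectType F)
    (Q : {symmetric V}) (n : nat) (e : n.-tuple V) : Prop :=
  forall i j : 'I_n, i != j -> Q (tnth e i) (tnth e j) = 0.

(* Main.v *)
(* The universal property makes [V] generate [C], so the ordered products
   [e_I] (the blades) span [C].  Each [e_j] commutes or anticommutes with
   [e_I] according to the parity of [#|I \ {j}|], and [e_j] is invertible.
   Hence for a central [z] written as a combination of blades, the blades
   anticommuting with [e_j] contribute [0] and may be dropped.  Doing this for
   every [j] leaves only the blades commuting with all [e_j]: [1], and also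
   [omega] when [n] is odd.  Linear independence of the blades is not needed. *)
Require Import Defs.
From HB Require Import structures.
From mathcomp Require Import all_boot all_order all_algebra.
From mathcomp Require boolp.

Set Implicit Arguments.
Unset Strict Implicit.
Unset Printing Implicit Defensive.

Import GRing.Theory.
Local Open Scope ring_scope.

(** The universal property quantifies over [algType], so a subalgebra must become a type before it
    can be the target of a morphism. *)
Record subalg_of (F : fieldType) (C : algType F) (S : subalgClosed C) :=
  SubalgOf { subalg_val : C; _ : subalg_val \in S }.

Section SubalgOf.
Variables (F : fieldType) (C : algType F) (S : subalgClosed C).

HB.instance Definition _ := [isSub for @subalg_val F C S].
HB.instance Definition _ := [Choice of subalg_of S by <:].
HB.instance Definition _ := [SubChoice_isSubAlgebra of subalg_of S by <:].
HB.instance Definition _ :=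
  GRing.RMorphism.copy (@subalg_val F C S) (\val : subalg_of S -> C).
HB.instance Definition _ :=
  GRing.Linear.copy (@subalg_val F C S) (\val : subalg_of S -> C).

End SubalgOf.

(** * Generation of the Clifford algebra by [V] *)

Section Generation.
Variables (F : fieldType) (V : vectType F) (Q : {symmetric V}).
Variables (C : algType F) (iota : {linear V -> C}).
Hypothesis cl : is_clifford_algebra Q iota.

(* The inclusion of the subalgebra composed with the map [C -> S] given by
   the universal property fixes [V], hence is the identity. *)
Lemma clifford_subalgebra (S : subalgClosed C) :
  (forall v, iota v \in S) -> forall x, x \in S.
Proof.
move=> iS x.
pose f0 v : subalg_of S := SubalgOf (iS v).
have f0lin : linear f0 by move=> a u v; apply: val_inj; rewrite /= linearP.
pose f : {linear V -> subalg_of S} :=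
  HB.pack f0 (GRing.isLinear.Build F V (subalg_of S) *:%R f0 f0lin).
have fsqr v : f v * f v = - (Q v v)%:A.
  by apply: val_inj; exact: (clifford_sqr cl).
have [g gf] := clifford_ex cl fsqr.
pose h : {lrmorphism C -> C} := @subalg_val F C S \o g.
have hE : h =1 idfun.
  apply: (@clifford_uniq _ _ _ _ _ cl C iota (clifford_sqr cl) h idfun) => v //=.
  by rewrite gf.
by have -> : x = h x; [rewrite hE | exact: valP].
Qed.

(** The elements satisfying [P] form a subalgebra containing [V]; classical logic makes [P] a
    boolean predicate. *)
Lemma clifford_ind (P : C -> Prop) :
  P 1 -> (forall a x y, P x -> P y -> P (a *: x + y)) ->
  (forall x y, P x -> P y -> P (x * y)) -> (forall v, P (iota v)) ->
  forall x, P x.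
Proof.
move=> P1 PD PM Pv x.
pose S : {pred C} := [pred x | boolp.asbool (P x)].
have Scl : subalg_closed S.
  split; first exact/boolp.asboolP.
  - by move=> a u v /boolp.asboolP Pu /boolp.asboolP Pw; apply/boolp.asboolP/PD.
  - by move=> u v /boolp.asboolP Pu /boolp.asboolP Pw; apply/boolp.asboolP/PM.
pose S' : subalgClosed C := HB.pack S (GRing.isSubalgClosed.Build F C S Scl).
suff: x \in S' by move/boolp.asboolP.
by apply: clifford_subalgebra => v; apply/boolp.asboolP.
Qed.

End Generation.

(** * Blades of anticommuting generators with scalar squares *)

Section Anticommuting.
Variables (F : fieldType) (C : algType F) (n : nat).
Variables (e : 'I_n -> C) (q : 'I_n -> F).
Hypothesis eC : forall i j, i != j -> e i * e j = - (e j * e i).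
Hypothesis eS : forall i, e i * e i = (q i)%:A.

Definition blade (I : {set 'I_n}) : C := \prod_(i in I) e i.

Lemma blade0 : blade set0 = 1.
Proof. exact: big_set0. Qed.

Lemma bladeT : blade setT = \prod_(i < n) e i.
Proof. by apply: eq_bigl => i; rewrite inE. Qed.

(** Each factor other than [e j] that is crossed costs one sign; [e j] commutes with itself. *)
Lemma mul_prod_anticomm (s : seq 'I_n) (P : pred 'I_n) j :
  e j * (\prod_(i <- s | P i) e i) =
  (-1) ^+ count [pred i | P i && (i != j)] s *:
    (\prod_(i <- s | P i) e i * e j).
Proof.
elim: s => [|i s IHs]; first by rewrite !big_nil mulr1 mul1r scale1r.
rewrite !big_cons /=; case: (P i) => //=.
have [->|neq_ij] := eqVneq i j; first by rewrite -mulrA {1}IHs -scalerAr.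
rewrite mulrA eC 1?eq_sym // mulNr -!mulrA IHs exprS mulN1r scaleNr.
by rewrite -scalerAr.
Qed.

Lemma mul_blade_anticomm j (I : {set 'I_n}) :
  e j * blade I = (-1) ^+ odd #|I :\ j| *: (blade I * e j).
Proof.
rewrite signr_odd mul_prod_anticomm -sum1_count -sum1_card.
by congr (_ ^+ _ *: _); apply: eq_bigl => i; rewrite !inE andbC.
Qed.

(** Moved by signs to its place in the order, [e j] is either inserted there or meets another [e j]
    and contracts to the scalar [q j]. *)
Lemma mul_prod_toggle (s : seq 'I_n) (I : {set 'I_n}) j :
  uniq s -> j \in s ->
  exists c, e j * (\prod_(i <- s | i \in I) e i) =
    c *: \prod_(i <- s | i \in [set k | (k == j) (+) (k \in I)]) e i.
Proof.
elim: s => //= i s IHs /andP[iNs s_uniq]; rewrite !big_cons !inE.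
have [ji _|neq_ij] := eqVneq j i.
  rewrite -{i}ji in iNs *.
  (* As [j] is absent from the tail, toggling it leaves the tail product unchanged. *)
  have -> : \prod_(k <- s | k \in [set k | (k == j) (+) (k \in I)]) e k =
            \prod_(k <- s | k \in I) e k.
    rewrite -big_filter -[RHS]big_filter; congr (\prod_(k <- _) _).
    apply: eq_in_filter => k ks; rewrite inE.
    by have [kj|//] := eqVneq k j; rewrite -kj ks in iNs.
  by case: (j \in I) => /=; [exists (q j); rewrite mulrA eS mulr_algl
                            | exists 1; rewrite scale1r].
move=> /= js; have [c IH] := IHs s_uniq js.
case: (i \in I) => /=; last by exists c.
by exists (- c); rewrite mulrA eC // mulNr -mulrA IH scaleNr scalerAr.
Qed.

Lemma mul_blade_toggle j (I : {set 'I_n}) :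
  exists c, e j * blade I = c *: blade [set k | (k == j) (+) (k \in I)].
Proof. by apply: mul_prod_toggle; rewrite ?index_enum_uniq ?mem_index_enum. Qed.

(** Bringing the two copies of the head together crosses the whole tail, which gives [size s] signs;
    Pascal's rule adds them to the exponent. *)
Lemma sqr_prod_anticomm (s : seq 'I_n) : uniq s ->
  (\prod_(i <- s) e i) ^+ 2 =
  (-1) ^+ 'C(size s, 2) *: \prod_(i <- s) e i ^+ 2.
Proof.
elim: s => [|i s IHs] /=; first by rewrite !big_nil expr1n scale1r.
move=> /andP[iNs /IHs IH]; rewrite !big_cons binS bin1 addnC exprD.
rewrite -scalerA scalerAr -IH !expr2 -!mulrA scalerAr; congr (_ * _).
rewrite !mulrA (mul_prod_anticomm s xpredT) (_ : count _ s = size s); last first.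
  apply/eqP; rewrite -all_count; apply/allP => j js /=.
  by apply: contraNneq iNs => <-.
by rewrite -scalerAl scalerA -expr2 sqrr_sign scale1r.
Qed.

Hypothesis e_ind : forall P : C -> Prop,
  P 1 -> (forall a x y, P x -> P y -> P (a *: x + y)) ->
  (forall x y, P x -> P y -> P (x * y)) -> (forall i, P (e i)) ->
  forall x, P x.

Lemma blade_span x : exists c : {set 'I_n} -> F, x = \sum_I c I *: blade I.
Proof.
pose Sp y := exists c : {set 'I_n} -> F, y = \sum_I c I *: blade I.
have SpB I : Sp (blade I).
  exists (fun J => (J == I)%:R); rewrite (bigD1 I) //= eqxx scale1r.
  by rewrite big1 ?addr0 // => J /negPf->; rewrite scale0r.
have SpD a y z : Sp y -> Sp z -> Sp (a *: y + z).
  move=> [c ->] [d ->]; exists (fun I => a * c I + d I).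
  rewrite scaler_sumr -big_split; apply: eq_bigr => I _ /=.
  by rewrite scalerDl scalerA.
have Sp0 : Sp 0 by rewrite -[0](addNr (blade set0)) -scaleN1r; apply: SpD.
(* Strengthened claim: [x * blade J] lies in the span for every [J], so that the product case of the
   induction composes. *)
rewrite -[x]mulr1 -blade0; move: (set0) => J; elim/e_ind: x J.
- by move=> J; rewrite mul1r; apply: SpB.
- by move=> a x y IHx IHy J; rewrite mulrDl -scalerAl; apply: SpD.
- move=> x y IHx IHy J; rewrite -mulrA; have [c ->] := IHy J.
  rewrite mulr_sumr; apply: (big_ind Sp) => // [u v Su Sv|I _].
    by rewrite -[u]scale1r; apply: SpD.
  by rewrite -scalerAr -[_ *: _]addr0; apply: SpD.
- move=> i J; have [c ->] := mul_blade_toggle i J.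
  by rewrite -[_ *: _]addr0; apply: SpD.
Qed.

(** Evenness of [#|I :\ j|] makes membership of [j] in [I] equivalent to oddness of [#|I|], a
    condition independent of [j]. *)
Lemma blades_commuting_with_all (I : {set 'I_n}) :
  (forall j, ~~ odd #|I :\ j|) -> I = set0 \/ I = setT /\ odd n.
Proof.
move=> evI; have oddI j : (j \in I) = odd #|I|.
  by rewrite (cardsD1 j) oddD (negPf (evI j)) addbF oddb.
case: (boolP (odd #|I|)) => oI; [right | left].
  have IT : I = setT by apply/setP => j; rewrite inE oddI.
  by split=> //; rewrite IT cardsT card_ord in oI.
by apply/setP => j; rewrite inE oddI (negPf oI).
Qed.

Hypothesis charF : 2%N \notin [pchar F].
Hypothesis q_neq0 : forall i, q i != 0.

(** Write [z] as [B + A], with [B] anticommuting and [A] commuting with [e j]. Centrality gives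
    [2 B e_j = 0], and multiplying by [e j] on the right gives [2 q_j B = 0], so [B] vanishes. *)
Lemma central_part (z : C) (P : pred {set 'I_n}) c j : in_center z ->
  z = \sum_(I | P I) c I *: blade I ->
  z = \sum_(I | P I && ~~ odd #|I :\ j|) c I *: blade I.
Proof.
move=> zC zE; have := zC (e j); rewrite zE.
rewrite (bigID (fun I : {set 'I_n} => odd #|I :\ j|)) /=.
set B := (X in X + _); set A := \sum_(I | _ && ~~ _) _.
have eA : e j * A = A * e j.
  rewrite mulr_sumr mulr_suml; apply: eq_bigr => I /andP[_ /negPf oI].
  by rewrite -scalerAr mul_blade_anticomm oI scale1r scalerAl.
have eB : e j * B = - (B * e j).
  rewrite mulr_sumr mulr_suml -sumrN; apply: eq_bigr => I /andP[_ oI].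
  by rewrite -scalerAr mul_blade_anticomm oI scaleN1r scalerN scalerAl.
rewrite mulrDl mulrDr eA eB => /addIr/eqP; rewrite -subr_eq0 opprK -mulr2n.
move=> /eqP /(congr1 ( *%R^~ (e j))).
rewrite mul0r mulrnAl -mulrA eS mulr_algr -scaler_nat scalerA => /eqP.
rewrite scaler_eq0 mulf_eq0 (negPf (q_neq0 j)) orbF => /orP[F2|/eqP->].
  by move: charF; rewrite inE /= F2.
by rewrite add0r.
Qed.

Lemma center_blade (z : C) : in_center z ->
  exists a b, z = a *: 1 + b *: blade setT /\ (~~ odd n -> b = 0).
Proof.
move=> zC; have [c zE] := blade_span z.
have {zE} -> : z = \sum_(I : {set 'I_n} |
    all (fun j => ~~ odd #|I :\ j|) (enum 'I_n)) c I *: blade I.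
  (* The indices [j] are imposed one at a time; the empty list gives back the full expansion of
     [z]. *)
  elim: (enum _) => //= j s IHs; rewrite (central_part j zC IHs).
  by apply: eq_bigl => I; rewrite andbC.
pose T x := exists a b, x = a *: 1 + b *: blade setT /\ (~~ odd n -> b = 0).
apply: (big_ind T).
- by exists 0, 0; rewrite !scale0r addr0.
- move=> x y [a [b [-> b0]]] [a' [b' [-> b'0]]].
  exists (a + a'), (b + b'); split; first by rewrite !scalerDl addrACA.
  by move=> nE; rewrite b0 ?b'0 ?addr0.
move=> I /allP evI; have [|->|[-> nO]] := @blades_commuting_with_all I.
- by move=> j; apply: evI; rewrite mem_enum.
- by exists (c set0), 0; rewrite scale0r addr0 blade0.
- by exists 0, (c setT); rewrite scale0r add0r nO.
Qed.

Lemma mul_bladeT j : e j * blade setT = (-1) ^+ n.-1 *: (blade setT * e j).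
Proof.
rewrite mul_blade_anticomm signr_odd cardsDS ?subsetT //.
by rewrite cardsT card_ord cards1 subn1.
Qed.

End Anticommuting.

(** * Orthogonal bases inside the Clifford algebra *)

Section OrthogonalBasis.
Variables (F : fieldType) (V : vectType F) (Q : {symmetric V}).
Variables (C : algType F) (iota : {linear V -> C}).
Hypothesis cl : is_clifford_algebra Q iota.
Variables (n : nat) (e : n.-tuple V).
Hypothesis e_basis : basis_of {:V} e.

(** Polarization: expand the square of [iota (u + v)]. *)
Lemma clifford_anticomm (u v : V) : Q u v = 0 ->
  iota u * iota v = - (iota v * iota u).
Proof.
move=> Quv; have Qvu : Q v u = 0 by apply/eqP; rewrite herm_eq0C Quv.
have := clifford_sqr cl (u + v).
rewrite linearD mulrDl !mulrDr !(clifford_sqr cl).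
rewrite linearDl /= !linearDr /= Quv Qvu addr0 add0r scalerDl opprD.
rewrite -addrA => /addrI; rewrite addrA -[RHS]add0r => /addIr/eqP.
by rewrite addr_eq0 => /eqP.
Qed.

Lemma clifford_basis_ind (P : C -> Prop) :
  P 1 -> (forall a x y, P x -> P y -> P (a *: x + y)) ->
  (forall x y, P x -> P y -> P (x * y)) -> (forall i, P (iota (tnth e i))) ->
  forall x, P x.
Proof.
move=> P1 PD PM Pe; apply: (clifford_ind cl) => // v.
have P0 : P 0 by rewrite -(addNr 1) -scaleN1r; apply: PD.
rewrite (coord_basis e_basis (memvf v)) linear_sum.
apply: (big_ind P) => // [x y Px Py|i _].
  by rewrite -[x]scale1r; apply: PD.
rewrite linearZ -tnth_nth -[X in P X]addr0; exact: PD.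
Qed.

(** Otherwise [e_i] would be orthogonal to the whole basis, hence lie in the radical and be zero. *)
Lemma orthogonal_basis_anisotropic i : nondegenerate Q ->
  orthogonal_family Q e -> Q (tnth e i) (tnth e i) != 0.
Proof.
move=> /eqP Qnd e_orth; apply/eqP => Qi.
have : tnth e i \in orthov Q fullv.
  apply/mem_orthovP => v _.
  rewrite (coord_basis e_basis (memvf v)) linear_sumr big1 // => j _ /=.
  rewrite linearZr /= -tnth_nth; have [<-|neq_ij] := eqVneq i j.
    by rewrite Qi mulr0.
  by rewrite e_orth // mulr0.
rewrite Qnd memv0 => /eqP ei0.
have := basis_free e_basis; rewrite /= => /free_not0 /(_ (mem_tnth i e)).
by rewrite ei0 eqxx.
Qed.

End OrthogonalBasis.

Theorem proposition5p1 (F : fieldType) (charF : 2%N \notin [pchar F])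
    (V : vectType F) (n : nat) (dimV : \dim {:V} = n)
    (Q : {symmetric V}) (Q_nondeg : nondegenerate Q)
    (C : algType F) (iota : {linear V -> C})
    (C_clifford : is_clifford_algebra Q iota)
    (alpha : {lrmorphism C -> C}) (alphaP : is_main_automorphism iota alpha)
    (e : n.-tuple V) (e_basis : basis_of {:V} e)
    (e_orth : orthogonal_family Q e) :
  let omega := \prod_(i < n) iota (tnth e i) in
  [/\ ~~ odd n ->
        (forall phi : C, phi * omega = omega * alpha phi) /\
        (forall z : C, in_center z <-> exists c : F, z = c%:A),
      odd n ->
        forall z : C, in_center z <-> exists a b : F, z = a *: 1 + b *: omega
    & omega ^+ 2 =
        (-1) ^+ (n * (n - 1) %/ 2) * \prod_(i < n) iota (tnth e i) ^+ 2].
Proof.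
move=> omega; pose ie i := iota (tnth e i).
pose q i := - Q (tnth e i) (tnth e i).
have ieS i : ie i * ie i = (q i)%:A.
  by rewrite /ie (clifford_sqr C_clifford) scaleNr.
have ieC i j : i != j -> ie i * ie j = - (ie j * ie i).
  by move=> neq_ij; apply: (clifford_anticomm C_clifford); rewrite e_orth.
have q_neq0 i : q i != 0 by rewrite oppr_eq0 orthogonal_basis_anisotropic.
have ind := clifford_basis_ind C_clifford e_basis.
have omegaE : omega = blade ie setT by rewrite bladeT.
have ie_omega j : ie j * omega = (-1) ^+ n.-1 *: (omega * ie j).
  by rewrite omegaE mul_bladeT.
split=> [nE|nO|].
- split=> [phi|z]; last first.
    split=> [zC|[c ->] x]; last by rewrite mulr_algl mulr_algr.
    have [a [b [-> /(_ nE) ->]]] := center_blade ieC ieS ind charF q_neq0 zC.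
    by exists a; rewrite scale0r addr0.
  (* Both sides are linear in [phi] and the identity passes to products, so only generators
     matter. *)
  elim/ind: phi => [|a x y IHx IHy|x y IHx IHy|j].
  + by rewrite rmorph1 mulr1 mul1r.
  + by rewrite linearP mulrDl mulrDr -scalerAl -scalerAr IHx IHy.
  + by rewrite rmorphM -mulrA IHy mulrA IHx mulrA.
  (* Here [n.-1] is odd, so [ie j] anticommutes with [omega], matching the sign of [alpha]. *)
  rewrite alphaP.2 mulrN ie_omega -signr_odd.
  have n_gt0 : (0 < n)%N := leq_ltn_trans (leq0n j) (ltn_ord j).
  by rewrite -[n]prednK // oddS negbK in nE; rewrite nE scaleN1r.
- move=> z; split=> [zC|[a [b ->]]].
    have [a [b [-> _]]] := center_blade ieC ieS ind charF q_neq0 zC.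
    by exists a, b; rewrite omegaE.
  set w := _ + _; elim/ind => [|c x y IHx IHy|x y IHx IHy|j].
  + by rewrite mulr1 mul1r.
  + by rewrite mulrDr [RHS]mulrDl IHy -scalerAr -scalerAl IHx.
  + by rewrite mulrA IHx -mulrA IHy mulrA.
  rewrite /w mulrDl mulrDr -!scalerAl -!scalerAr mul1r mulr1 ie_omega.
  (* Now [n.-1] is even, so [omega] commutes with every generator. *)
  have n_gt0 : (0 < n)%N := leq_ltn_trans (leq0n j) (ltn_ord j).
  rewrite -signr_odd; have := nO; rewrite -{1}[n]prednK //= => /negPf->.
  by rewrite scale1r.
rewrite (sqr_prod_anticomm ieC) ?index_enum_uniq //.
rewrite (_ : size _ = n) ?bin2; last by rewrite -sum1_size sum_nat_const card_ord muln1.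
(* One sign is a scalar of [F], the other an element of [C]; they are compared through the parity of
   the exponent. *)
rewrite divn2 subn1 -signr_odd -[in RHS]signr_odd.
by case: (odd _); rewrite ?scale1r ?mul1r // scaleN1r mulN1r.
Qed.
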